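(* Let $n\ge 2$, let $V$ be an $n$-dimensional complex vector space with orthonormal basis $e_1,\ldots,e_n$ for a nondegenerate symmetric bilinear form, $a_{ij}=e_i\wedge e_j\in\Lambda_2(V)$, and $A=(a_{ij})_{1\le i,j\le n}\in\operatorname{Mat}_{n,n}(\Lambda(\Lambda_2(V)))$. Then $$(n-2)A^{2n-3}-\sum_{0\le k\le m-2}\operatorname{tr}(A^{4k+3})A^{2n-3-4k-3}=0\qquad\text{if } n=2m,$$ $$nA^{2n-3}-\sum_{0\le k\le m-1}\operatorname{tr}(A^{4k+3})A^{2n-3-4k-3}=0\qquad\text{if } n=2m+1.$$
   Context: $\Lambda(\Lambda_2(V))$ is the exterior algebra on $\Lambda_2(V)$; its products are exterior products, and matrix products are taken with entries multiplied in the order written; $A^0$ is the identity matrix. *)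

(* Defs.v *)
From HB Require Import structures.
From mathcomp Require Import all_boot all_order all_algebra.
From mathcomp Require Import complex Rstruct.
Set Implicit Arguments. Unset Strict Implicit. Unset Printing Implicit Defensive.
Import Order.TTheory GRing.Theory Num.Theory.
Local Open Scope ring_scope.

Definition CC : fieldType := (Rdefinitions.R)[i].

(* Index set of the standard basis of Lambda_2(V), V = C^n with basis e_0..e_{n-1}:
   the wedges e_i /\ e_j with i < j. *)
Definition pairs (n : nat) := {p : 'I_n * 'I_n | (p.1 < p.2)%N}.

(* The exterior algebra Lambda(Lambda_2(V)) as a C-vector space with basis
   indexed by subsets S of [pairs n] (e_S = wedge of the generators in S in
   increasing order w.r.t. the fixed enumeration of pairs n). *)
Definition ext (n : nat) := {ffun {set pairs n} -> CC}.

Definition ext_inv n (S T : {set pairs n}) : nat :=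
  #|[set st : pairs n * pairs n | [&& st.1 \in S, st.2 \in T &
       (enum_rank st.2 < enum_rank st.1)%N]]|.

(* Exterior (wedge) product: e_S /\ e_T = (-1)^{inv(S,T)} e_{S u T} if S, T
   disjoint, and 0 otherwise; extended bilinearly. *)
Definition ext_mul n (x y : ext n) : ext n :=
  [ffun U => \sum_(S : {set pairs n}) \sum_(T : {set pairs n})
     if [&& [disjoint S & T] & S :|: T == U]
     then (-1) ^+ ext_inv S T * x S * y T else 0].

Definition ext_one n : ext n := [ffun S => (S == set0)%:R].

Definition ext_gen n (g : pairs n) : ext n := [ffun S => (S == [set g])%:R].

(* a_ij = e_i /\ e_j ; so a_ij = -a_ji and a_ii = 0. *)
Definition wedge2 n (i j : 'I_n) : ext n :=
  match insub (i, j) : option (pairs n) with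
  | Some g => ext_gen g
  | None => 0
  end.
Definition a_entry n (i j : 'I_n) : ext n := wedge2 i j - wedge2 j i.

Definition Amx n : 'M[ext n]_n := \matrix_(i, j) a_entry i j.

Definition mxmulE n (A B : 'M[ext n]_n) : 'M[ext n]_n :=
  \matrix_(i, j) \sum_k ext_mul (A i k) (B k j).
Definition mxoneE n : 'M[ext n]_n := \matrix_(i, j) (ext_one n *+ (i == j)).
Definition mxpowE n (A : 'M[ext n]_n) (k : nat) : 'M[ext n]_n :=
  iter k (mxmulE A) (mxoneE n).
Definition mxtrE n (A : 'M[ext n]_n) : ext n := \sum_i A i i.
Definition mxscaleE n (t : ext n) (B : 'M[ext n]_n) : 'M[ext n]_n :=
  \matrix_(i, j) ext_mul t (B i j).

(* Main.v *)
(* Write B = A^2: its entries lie in a commutative ring, B is skew, and all traces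
   of its positive powers vanish because A has anticommuting entries; hence the
   characteristic polynomial of B is X^N with N = n.  By Jacobi's complementary minor formula
   the 3 x 3 minors of the resolvent sum_k X^(N-1-k) B^k are divisible by X^(2N),
   so that

     sum_(p+q+r = N-2) (the alternating product of B^p, B^q, B^r
                        over rows a, u, w and columns b, v, z)  =  0.

   Contracting with A_uw on the left and A_vz on the right kills the terms that
   contain a closed trace and turns each of the others into a signed copy of
   A^(2N-2); the total coefficient is -4 floor(N/2), whence A^(2N-2) = 0.

   That identity holds for every skew matrix with anticommuting entries over a
   torsion-free ring, in particular for the entries [[a_ij, y_ij], [0, -a_ij]]
   with Y = E_pq - E_qp.  The upper right corner of its (2N-2)-nd power gives

     sum_i (-1)^i A^i Y A^(2N-3-i) = 0,

   and summing the (a, b) entries for p = a over a yields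
   sum_i (-1)^i tr(A^i) A^(2N-3-i) = (sum_i (-1)^C(i,2)) A^(2N-3), where
   (A^i)^T = (-1)^C(i+1,2) A^i.  Only tr(A^0) = N and the tr(A^(4k+3)) survive. *)
Require Import Defs.
From HB Require Import structures.
From mathcomp Require Import all_boot all_order all_algebra.
From mathcomp Require Import zify ring complex Rstruct boolp.
Set Implicit Arguments. Unset Strict Implicit. Unset Printing Implicit Defensive.
Import GRing.Theory.
Local Open Scope ring_scope.

(** * Characteristic polynomials and minors of the resolvent *)

Lemma deriv_prod (R : comNzRingType) n (F : 'I_n -> {poly R}) :
  (\prod_i F i)^`() = \sum_i (F i)^`() * \prod_(j | j != i) F j.
Proof.
elim: n F => [|n IHn] F; first by rewrite !big_ord0 derivC.
rewrite big_ord_recl derivM IHn [RHS]big_ord_recl; congr (_ * _ + _).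
  by rewrite [RHS]big_mkcond big_ord_recl /= mul1r; apply: eq_bigr.
rewrite big_distrr /=; apply: eq_bigr => i _.
rewrite [in RHS]big_mkcond big_ord_recl /= mulrCA; congr (_ * (_ * _)).
by rewrite big_mkcond.
Qed.

(** Jacobi's formula: the product rule differentiates one row at a time, and expanding along that
    row yields the cofactors. *)
Lemma deriv_det (R : comNzRingType) n (M : 'M[{poly R}]_n) :
  (\det M)^`() = \tr (map_mx deriv M *m \adj M).
Proof.
pose N i := \matrix_(k, j) if k == i then (M k j)^`() else M k j.
transitivity (\sum_i \det (N i)).
  rewrite /determinant raddf_sum exchange_big /=; apply: eq_bigr => s _.
  rewrite -big_distrr /= -signr_odd -polyC1 -polyCN -polyC_exp derivM derivC mul0r add0r.
  rewrite deriv_prod; congr (_ * _); apply: eq_bigr => i _.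
  rewrite [RHS](bigD1 i) //= mxE eqxx; congr (_ * _).
  by apply: eq_bigr => j /negPf nij; rewrite mxE nij.
apply: eq_bigr => i _; rewrite (expand_det_row _ i) mxE; apply: eq_bigr => j _.
rewrite !mxE eqxx; congr (_ * (_ * \det _)).
by apply/matrixP => k l; rewrite !mxE eq_sym (negPf (neq_lift _ _)).
Qed.

Lemma deriv_char_poly (R : comNzRingType) n (B : 'M[R]_n) :
  (char_poly B)^`() = \tr (\adj (char_poly_mx B)).
Proof.
rewrite deriv_det; have ->: map_mx deriv (char_poly_mx B) = 1%:M.
  apply/matrixP => i j; rewrite !mxE derivB derivC subr0.
  by case: (i == j); rewrite ?mulr1n ?derivX // mulr0n deriv0.
by rewrite mul1mx.
Qed.

(* Newton's identities in the form [X p' = n p + \tr (B \adj (X - B))]; the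
   last trace is a combination of traces of positive powers of [B]. *)
Lemma char_poly_tr0 (R : comNzRingType) n (B : 'M[R]_n.+1) :
  (forall (x : R) k, x *+ k.+1 = 0 -> x = 0) ->
  (forall k, \tr (B ^+ k.+1) = 0) -> char_poly B = 'X^(n.+1).
Proof.
move=> tfR trB; pose p := char_poly B; pose M := \adj (char_poly_mx B).
pose C k := map_mx (coefp k) M.
have adjE : char_poly_mx B *m M = p%:M by exact: mul_mx_adj.
have Crec k : C k = p`_k.+1 *: 1%:M + B * C k.+1.
  apply/matrixP => i j; have /matrixP/(_ i j)/(congr1 (coefp k.+1)) := adjE.
  rewrite mulmxBl mul_scalar_mx /= !mxE coefB coefXM /= coefMn mulr_natr.
  move/eqP; rewrite subr_eq => /eqP->; congr (_ + _).
  by rewrite coef_sum; apply: eq_bigr => l _; rewrite !mxE coefCM.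
have [N CN] : exists N, forall k, (N <= k)%N -> C k = 0.
  exists (\max_i \max_j size (M i j)) => k leNk; apply/matrixP => i j.
  rewrite [LHS]mxE [RHS]mxE /= nth_default // (leq_trans _ leNk) //.
  apply: leq_trans (@leq_bigmax _ (fun i => \max_j size (M i j)) i).
  exact: (@leq_bigmax _ (fun j => size (M i j)) j).
(* Downward induction from [N]: [Crec] trades [C k] for [C k.+1] with one more factor [B], up to a
   multiple of a vanishing trace. *)
have trBC k j : \tr (B ^+ j.+1 * C k) = 0.
  have [/CN-> | /ltnW] := leqP N k; first by rewrite mulr0 raddf0.
  move=> leN; move Nk: (N - k)%N => d.
  elim: d k j Nk leN => [|d IHd] k j Nk leN.
    by rewrite CN ?mulr0 ?raddf0 // -subn_eq0 Nk.
  rewrite Crec mulrDr raddfD /= -scalerAr [_ * 1%:M]mulmx1 linearZ /= trB.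
  have ltkN : (k < N)%N by rewrite -subn_gt0 Nk.
  by rewrite mulr0 add0r mulrA -exprSr IHd // subnS Nk.
have coefp0 k : (k < n.+1)%N -> p`_k = 0.
  (* Comparing coefficients of ['X^k] gives [(n.+1 - k) p_k = 0]; the index is [n - k] because [tfR]
     cancels successors. *)
  move=> ltkn; apply: (tfR _ (n - k)%N).
  have /(congr1 (coefp k)) : 'X * p^`() = p *+ n.+1 + \tr (map_mx polyC B *m M).
    have /(congr1 mxtrace) := adjE.
    rewrite /char_poly_mx mulmxBl mul_scalar_mx raddfB /= linearZ /= mxtrace_scalar.
    by rewrite -deriv_char_poly => /eqP; rewrite subr_eq => /eqP->.
  rewrite /= coefD coefMn coefXM coef_deriv.
  have -> : (\tr (map_mx polyC B *m M))`_k = \tr (B ^+ 1 * C k).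
    rewrite expr1 /mxtrace coef_sum; apply: eq_bigr => i _.
    by rewrite !mxE coef_sum; apply: eq_bigr => l _; rewrite !mxE coefCM.
  rewrite trBC addr0 -subSn //; case: k ltkn => [|k] ltkn /=.
    by rewrite subn0 => <-.
  by move/esym/eqP; rewrite -subr_eq0 -mulrnBr ?(ltnW ltkn) // => /eqP.
apply/polyP => k; rewrite coefXn; case: ltngtP => [/coefp0 // | ltnk | ->].
  by rewrite nth_default // size_char_poly.
by have /monicP := char_poly_monic B; rewrite lead_coefE size_char_poly.
Qed.

(** Truncated geometric series: if [B ^+ n.+1 = 0], this is ['X^(n.+1)] times the inverse of
    [X - B]. *)
Definition resolvent (R : comNzRingType) n (B : 'M[R]_n.+1) : 'M[{poly R}]_n.+1 :=
  \sum_(k < n.+1) 'X^(n - k) *: map_mx polyC (B ^+ k).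

Lemma mul_char_poly_mx_resolvent (R : comNzRingType) n (B : 'M[R]_n.+1) :
  char_poly B = 'X^(n.+1) -> char_poly_mx B *m resolvent B = ('X^(n.+1))%:M.
Proof.
move=> chB; have B0 : B ^+ n.+1 = 0.
  by have := Cayley_Hamilton B; rewrite chB rmorphXn /= horner_mx_X.
have := @subrXX_comm _ 'X%:M (map_mx polyC B) n.+1 (comm_mx_sym (comm_mx_scalar _ _)).
rewrite -!rmorphXn /= B0 map_mx0 subr0 => ->; congr (_ * _).
by apply: eq_bigr => k _; rewrite -!rmorphXn /= -mul_scalar_mx.
Qed.

(* Jacobi's complementary minor formula, read off the bordered determinant
   [[X - B, U], [W, 0]]. *)
Lemma det_compress_resolvent (R : comNzRingType) n r (B : 'M[R]_n.+1)
    (W : 'M[{poly R}]_(r, n.+1)) (U : 'M[{poly R}]_(n.+1, r)) :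
  char_poly B = 'X^(n.+1) ->
  exists P, \det (W *m resolvent B *m U) * 'X^(n.+1) = P * 'X^(n.+1 * r).
Proof.
move=> chB; set Q := resolvent B; set M := char_poly_mx B.
have MQ : M *m Q = ('X^(n.+1))%:M by exact: mul_char_poly_mx_resolvent.
pose P := (-1) ^+ r * \det (block_mx M U W 0); exists P.
have detM : \det M = 'X^(n.+1) by [].
have detQ : \det Q * 'X^(n.+1) = 'X^(n.+1 * n.+1).
  by rewrite -detM mulrC -det_mulmx MQ det_scalar -exprM.
have regX k : GRing.lreg ('X^k : {poly R}) by apply: monic_lreg; apply: monicXn.
(* The second factor clears the block [U] by column operations and leaves the compressed resolvent
   in the corner. *)
have : block_mx M U W 0 *m block_mx Q (- (Q *m U)) 0 ('X^(n.+1))%:M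
    = block_mx ('X^(n.+1))%:M 0 (W *m Q) (- (W *m Q *m U)).
  rewrite mulmx_block !mulmx0 !mul0mx !addr0 MQ !mulmxN !mulmxA MQ.
  by rewrite mul_mx_scalar mul_scalar_mx addNr.
have ee : (-1) ^+ r * (-1) ^+ r = 1 :> {poly R} by rewrite -signr_odd -expr2 sqrr_sign.
move/(congr1 determinant); rewrite det_mulmx det_ublock det_lblock !det_scalar.
rewrite -scaleN1r detZ -!exprM => /(congr1 (fun x => (-1) ^+ r * x * 'X^(n.+1))) E.
(* [R] may have zero divisors, but powers of X can be cancelled, and [\det Q] divides one of
   them. *)
apply: (regX (n.+1 * n.+1)%N); rewrite -{2}detQ /P.
transitivity ((-1) ^+ r * ('X^(n.+1 * n.+1) * ((-1) ^+ r * \det (W *m Q *m U)))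
              * 'X^(n.+1)); last by rewrite -E; ring.
by rewrite -[LHS]mul1r -[X in X * _ = _]ee; ring.
Qed.

Lemma det_mx3 (R : comNzRingType) (D : 'M[R]_3) :
  let d i j := D (inord i) (inord j) in
  \det D = d 0%N 0%N * d 1%N 1%N * d 2%N 2%N - d 0%N 0%N * d 1%N 2%N * d 2%N 1%N
         - d 0%N 1%N * d 1%N 0%N * d 2%N 2%N + d 0%N 1%N * d 1%N 2%N * d 2%N 0%N
         + d 0%N 2%N * d 1%N 0%N * d 2%N 1%N - d 0%N 2%N * d 1%N 1%N * d 2%N 0%N.
Proof.
move=> d; have dE i j : D i j = d i j by rewrite /d !inord_val.
rewrite (expand_det_row _ ord0) !big_ord_recl big_ord0 /cofactor.
rewrite !(expand_det_row _ ord0) !big_ord_recl !big_ord0 /cofactor !det_mx11 !mxE !dE /=.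
rewrite /bump /= !addr0 !add0n.
rewrite -[(1 + (1 + 0))%N]/2%N -[(1 + 0)%N]/1%N; ring.
Qed.

(** The exponents are reversed: [(n - p) + (n - q) + (n - r)] equals [n.*2.+1] exactly when
    [(p + q + r).+1 = n]. *)
Lemma coef_prod3_rev (R : comNzRingType) n (a b c : nat -> R) :
  ((\sum_(k < n.+1) 'X^(n - k) * (a k)%:P) * (\sum_(k < n.+1) 'X^(n - k) * (b k)%:P)
     * (\sum_(k < n.+1) 'X^(n - k) * (c k)%:P))`_(n.*2.+1)
  = \sum_(t : 'I_n.+1 * 'I_n.+1 * 'I_n.+1 | (t.1.1 + t.1.2 + t.2).+1 == n)
      a t.1.1 * b t.1.2 * c t.2.
Proof.
rewrite big_distrlr /= pair_bigA big_distrlr /= pair_bigA coef_sum [RHS]big_mkcond /=.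
apply: eq_bigr => -[[p q] r] _ /=.
have -> : 'X^(n - p) * (a p)%:P * ('X^(n - q) * (b q)%:P) * ('X^(n - r) * (c r)%:P)
    = 'X^(n - p + (n - q) + (n - r)) * (a p * b q * c r)%:P.
  by rewrite !exprD !polyCM; ring.
rewrite coefMC coefXn.
have [[ltp ltq] ltr] := (ltn_ord p, ltn_ord q, ltn_ord r).
case: ifP => Ht; first by rewrite (_ : _ == _ = true) ?mul1r //; lia.
by rewrite (_ : _ == _ = false) ?mul0r //; lia.
Qed.

(** For [r = 3] the compression formula makes the minor divisible by ['X^(2 * n.+1)]; the highest
    coefficient forced to vanish, at [n.*2.+1], is this sum. *)
Lemma resolvent_minor3 (R : comNzRingType) n (B : 'M[R]_n.+1) (a u w b v z : 'I_n.+1) :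
  char_poly B = 'X^(n.+1) ->
  \sum_(t : 'I_n.+1 * 'I_n.+1 * 'I_n.+1 | (t.1.1 + t.1.2 + t.2).+1 == n)
    ((B ^+ t.1.1) a b * (B ^+ t.1.2) u v * (B ^+ t.2) w z
     - (B ^+ t.1.1) a b * (B ^+ t.1.2) u z * (B ^+ t.2) w v
     - (B ^+ t.1.1) a v * (B ^+ t.1.2) u b * (B ^+ t.2) w z
     + (B ^+ t.1.1) a v * (B ^+ t.1.2) u z * (B ^+ t.2) w b
     + (B ^+ t.1.1) a z * (B ^+ t.1.2) u b * (B ^+ t.2) w v
     - (B ^+ t.1.1) a z * (B ^+ t.1.2) u v * (B ^+ t.2) w b) = 0.
Proof.
move=> chB.
pose i (s : 'I_3) := nth a [:: a; u; w] s; pose j (s : 'I_3) := nth b [:: b; v; z] s.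
have [P detE] := det_compress_resolvent (rowsub i 1%:M) (colsub j 1%:M) chB.
have := congr1 (fun p : {poly R} => p`_(n.*2.+1 + n.+1)) detE.
rewrite /= coefMXn coefMXn /= ltnNge leq_addl addnK /= => D0.
rewrite ifT in D0; last by lia.
rewrite -[RHS]D0 mulmx_colsub mulmx1 mul_rowsub_mx mul1mx det_mx3 !mxE.
rewrite /i /j !inordK //=.
pose e k l s := (B ^+ s) k l.
have dE k l : resolvent B k l = \sum_(s < n.+1) 'X^(n - s) * (e k l s)%:P.
  by rewrite summxE; apply: eq_bigr => s _; rewrite !mxE.
rewrite !dE !(coefB, coefD) !coef_prod3_rev.
by rewrite -!(big_split, sumrB).
Qed.

(** * Commuting entries *)

Section CenterOfCentralizer.
Variables (E : nzRingType) (I : Type) (F : I -> E).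

Definition centralizes (x : E) := forall i, GRing.comm x (F i).

(** If the [F i] commute with one another, this is a commutative subring containing all of them. *)
Definition cent_center : pred E :=
  fun x => `[< centralizes x /\ forall y, centralizes y -> GRing.comm x y >].

Lemma cent_center_subring : subring_closed cent_center.
Proof.
split=> [|x y|x y].
- apply/asboolP; split=> [i|y _]; exact/commr_sym/commr1.
- move=> /asboolP[xF xC] /asboolP[yF yC]; apply/asboolP; split=> [i|z zF].
    by apply/commr_sym/commrB; apply/commr_sym.
  by apply/commr_sym/commrB; apply/commr_sym; [apply: xC | apply: yC].
- move=> /asboolP[xF xC] /asboolP[yF yC]; apply/asboolP; split=> [i|z zF].
    by apply/commr_sym/commrM; apply/commr_sym.
  by apply/commr_sym/commrM; apply/commr_sym; [apply: xC | apply: yC].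
Qed.

HB.instance Definition _ :=
  GRing.isSubringClosed.Build E cent_center cent_center_subring.

Record cent_center_sub := CentCenter { cc_val :> E; _ : cc_val \in cent_center }.

HB.instance Definition _ := [isSub for cc_val].
HB.instance Definition _ := [Choice of cent_center_sub by <:].
HB.instance Definition _ := [SubChoice_isSubNzRing of cent_center_sub by <:].

Lemma cent_center_mulC : commutative (@GRing.mul cent_center_sub).
Proof.
move=> x y; apply: val_inj; rewrite !rmorphM /=.
by have /asboolP[xF xC] := valP x; have /asboolP[yF _] := valP y; apply: xC.
Qed.

HB.instance Definition _ :=
  GRing.PzRing_hasCommutativeMul.Build cent_center_sub cent_center_mulC.

End CenterOfCentralizer.

(** Determinants need a commutative base ring; this moves the entries of [A ^+ 2] into one. *)
Lemma commuting_lift (E : nzRingType) m n (B : 'M[E]_(m, n)) :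
  (forall i j k l, GRing.comm (B i j) (B k l)) ->
  exists (R : comNzRingType) (f : {rmorphism R -> E}),
    injective f /\ exists B0, map_mx f B0 = B.
Proof.
move=> cB; pose F (ij : 'I_m * 'I_n) := B ij.1 ij.2.
have BP i j : B i j \in cent_center F.
  by apply/asboolP; split=> [kl|y yF]; [apply: cB | apply/commr_sym/(yF (i, j))].
exists (cent_center_sub F), (val : cent_center_sub F -> E); split; first exact: val_inj.
by exists (\matrix_(i, j) CentCenter (BP i j)); apply/matrixP => i j; rewrite !mxE.
Qed.

(** * Skew matrices with anticommuting entries *)

Lemma bin2_sign (R : nzRingType) k : (-1) ^+ 'C(k.*2.+1, 2) = (-1) ^+ k :> R.
Proof.
rewrite -signr_odd -[RHS]signr_odd bin2 /=; congr (_ ^+ nat_of_bool _).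
by rewrite -doubleMr doubleK oddM /= odd_double.
Qed.

Lemma card_compl_pairs n r :
  (\sum_(p < n.+1) \sum_(q < n.+1 | (p + q + r).+1 == n) 1 = n - r)%N.
Proof.
transitivity (\sum_(p < n.+1) (p < n - r))%N.
  apply: eq_bigr => p _; rewrite ltn_subRL addnC; case: ltnP => ltpr.
    rewrite (big_pred1 (inord (n - (p + r).+1))) // => q /=.
    by rewrite -val_eqE /= inordK; have := ltn_ord q; lia.
  by rewrite big_pred0 // => q /=; lia.
rewrite -big_mkcond -(big_ord_widen_cond _ xpredT (fun=> 1)) ?leqW ?leq_subr //.
by rewrite sum1_card card_ord.
Qed.

(** A fixed [r] occurs for [n - r] pairs, and the alternating sum S(n) of these counts satisfies S(n
    + 1) = n + 1 - S(n). *)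
Lemma sum_sign_compositions (R : nzRingType) n :
  \sum_(t : 'I_n.+1 * 'I_n.+1 * 'I_n.+1 | (t.1.1 + t.1.2 + t.2).+1 == n) (-1) ^+ t.2
  = (uphalf n)%:R :> R.
Proof.
transitivity (\sum_(r < n.+1) (-1) ^+ r *+ (n - r) : R).
  rewrite big_mkcond -(pair_bigA _ (fun (pq : 'I_n.+1 * 'I_n.+1) (r : 'I_n.+1) =>
    if (pq.1 + pq.2 + r).+1 == n then (-1) ^+ r else 0)) /= exchange_big /=.
  apply: eq_bigr => r _; rewrite -(card_compl_pairs n r).
  rewrite -(pair_bigA _ (fun p q : 'I_n.+1 =>
    if (p + q + r).+1 == n then (-1) ^+ r else 0)) /=.
  rewrite -sumrMnr; apply: eq_bigr => p _; rewrite -sumrMnr [RHS]big_mkcond.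
  by apply: eq_bigr => q _; case: ifP.
elim: n => [|n IHn]; first by rewrite big_ord1.
rewrite big_ord_recl subn0 expr0.
under eq_bigr => r _ do rewrite lift0 subSS exprS mulN1r mulNrn.
rewrite sumrN IHn -natrB.
  by congr (_%:R); rewrite -{1}(odd_double_half n) uphalf_half; lia.
by rewrite uphalf_half; lia.
Qed.

Lemma mulmx4E (R : pzSemiRingType) n (M1 M2 M3 M4 : 'M[R]_n) i j :
  (M1 *m M2 *m M3 *m M4) i j
  = \sum_l3 \sum_l2 \sum_l1 M1 i l1 * M2 l1 l2 * M3 l2 l3 * M4 l3 j.
Proof.
rewrite mxE; apply: eq_bigr => l3 _; rewrite mxE mulr_suml; apply: eq_bigr => l2 _.
by rewrite mxE !mulr_suml.
Qed.

Section OddSkew.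
Variables (E : nzRingType) (n : nat) (A : 'M[E]_n.+1).
Hypothesis torsion_free : forall (x : E) k, x *+ k.+1 = 0 -> x = 0.
Hypothesis anticomm : forall i j k l, A i j * A k l = - (A k l * A i j).
Hypothesis skew : forall i j, A i j = - A j i.

(** An entry of [A ^+ p] is a sum of products of [p] anticommuting elements; passing it across [m]
    others costs [p * m] signs. *)
Lemma pow_superC p m i j k l :
  (A ^+ p) i j * (A ^+ m) k l = (-1) ^+ (p * m) * ((A ^+ m) k l * (A ^+ p) i j).
Proof.
have mone a b : (A ^+ 0) a b = (a == b)%:R by rewrite expr0 mxE.
have one m' a b c d : A a b * (A ^+ m') c d = (-1) ^+ m' * ((A ^+ m') c d * A a b).
  elim: m' c d => [|m' IH] c d; first by rewrite mone mul1r commr_nat.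
  rewrite [A ^+ m'.+1]exprS mxE mulr_sumr mulr_suml mulr_sumr; apply: eq_bigr => s _.
  rewrite [LHS]mulrA anticomm [LHS]mulNr -[in LHS]mulrA IH exprS !mulN1r !mulNr.
  by rewrite !mulrA commr_sign.
elim: p i j => [|p IH] i j; first by rewrite mone mul1r commr_nat.
rewrite mulSn exprD [A ^+ p.+1]exprS mxE mulr_suml !mulr_sumr.
apply: eq_bigr => s _.
rewrite -mulrA IH !mulrA commr_sign -!mulrA [X in _ * X]mulrA one.
by rewrite !mulrA -exprD addnC exprD.
Qed.

(** Cyclicity of the trace moves one odd entry past an odd power and so costs a sign: the trace is
    its own negative. *)
Lemma tr_pow_even k : \tr (A ^+ k.+1.*2) = 0.
Proof.
apply: (@torsion_free _ 1); rewrite mulr2n; apply/eqP; rewrite addr_eq0; apply/eqP.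
have trE : \tr (A ^+ k.+1.*2) = \sum_i \sum_j A i j * (A ^+ k.*2.+1) j i.
  by apply: eq_bigr => i _; rewrite doubleS exprS mxE.
rewrite [LHS]trE exchange_big /=.
have trE' : \tr (A ^+ k.+1.*2) = \sum_i \sum_j (A ^+ k.*2.+1) i j * A j i.
  by apply: eq_bigr => i _; rewrite doubleS exprSr mxE.
rewrite trE' -sumrN; apply: eq_bigr => i _; rewrite -sumrN; apply: eq_bigr => j _.
have := pow_superC 1 k.*2.+1 j i i j.
by rewrite !expr1 mul1n => ->; rewrite -signr_odd /= odd_double mulN1r.
Qed.

(** Reversing [m] anticommuting factors gives ['C(m, 2)] signs, and transposing each skew factor
    gives [m] more. *)
Lemma pow_trmx m i j : (A ^+ m) j i = (-1) ^+ 'C(m.+1, 2) * (A ^+ m) i j.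
Proof.
elim: m i j => [|m IH] i j; first by rewrite mul1r !mxE eq_sym.
rewrite binS bin1 [in LHS]exprS [in RHS]exprSr !mxE mulr_sumr; apply: eq_bigr => s _.
have := pow_superC 1 m s j i s; rewrite !expr1 mul1n => E1.
rewrite (skew j s) (IH i s) mulNr mulrA commr_sign -mulrA E1.
by rewrite exprD exprS mulN1r mulrN mulNr !mulrA.
Qed.

Lemma sq_pow_trmx m i j : (A ^+ m.*2) j i = (-1) ^+ m * (A ^+ m.*2) i j.
Proof. by rewrite pow_trmx bin2_sign. Qed.

Lemma sq_pow_comm m p i j k l :
  (A ^+ m.*2) i j * (A ^+ p) k l = (A ^+ p) k l * (A ^+ m.*2) i j.
Proof. by rewrite pow_superC -signr_odd oddM odd_double mul1r. Qed.

Lemma sq_char_poly (R : comNzRingType) (f : {rmorphism R -> E}) (B : 'M[R]_n.+1) :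
  injective f -> map_mx f B = A ^+ 2 -> char_poly B = 'X^(n.+1).
Proof.
move=> injf fB; apply: char_poly_tr0 => [x k xk0 | k].
  by apply: injf; rewrite rmorph0; apply: (@torsion_free _ k); rewrite -rmorphMn xk0 rmorph0.
apply: injf; rewrite rmorph0 -(tr_pow_even k) -trace_map_mx rmorphXn /= fB.
by rewrite -exprM mul2n.
Qed.

Let contraction (x : E) (u w z v : 'I_n.+1) := A u w * x * A v z.

Let con (x : 'I_n.+1 -> 'I_n.+1 -> 'I_n.+1 -> 'I_n.+1 -> E) : E :=
  \sum_u \sum_w \sum_z \sum_v contraction (x u w z v) u w z v.

Let eq_con x y : (forall u w z v, x u w z v = y u w z v) -> con x = con y.
Proof.
by move=> xy; apply: eq_bigr => u _; apply: eq_bigr => w _; apply: eq_bigr => z _;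
  apply: eq_bigr => v _; rewrite xy.
Qed.

Let conD x y : con (fun u w z v => x u w z v + y u w z v) = con x + con y.
Proof.
rewrite /con -big_split; apply: eq_bigr => u _; rewrite -big_split; apply: eq_bigr => w _.
rewrite -big_split; apply: eq_bigr => z _; rewrite -big_split; apply: eq_bigr => v _.
by rewrite /contraction mulrDr mulrDl.
Qed.

Let con_swapr x : con (fun u w z v => x u w v z) = - con x.
Proof.
rewrite /con -sumrN; apply: eq_bigr => u _; rewrite -sumrN; apply: eq_bigr => w _.
rewrite exchange_big -sumrN; apply: eq_bigr => z _; rewrite -sumrN; apply: eq_bigr => v _.
by rewrite /contraction (skew z v) mulrN.
Qed.

Let con_swapl x : con (fun u w z v => x w u z v) = - con x.
Proof.
rewrite /con exchange_big -sumrN; apply: eq_bigr => u _; rewrite -sumrN.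
apply: eq_bigr => w _; rewrite -sumrN; apply: eq_bigr => z _; rewrite -sumrN.
by apply: eq_bigr => v _; rewrite /contraction (skew w u) !mulNr.
Qed.

Let conN x : con (fun u w z v => - x u w z v) = - con x.
Proof.
rewrite /con -sumrN; apply: eq_bigr => u _; rewrite -sumrN; apply: eq_bigr => w _.
rewrite -sumrN; apply: eq_bigr => z _; rewrite -sumrN; apply: eq_bigr => v _.
by rewrite /contraction mulrN mulNr.
Qed.

Let con_sum (I : finType) (P : pred I) x :
  con (fun u w z v => \sum_(t | P t) x t u w z v) = \sum_(t | P t) con (x t).
Proof.
rewrite /con [RHS]exchange_big; apply: eq_bigr => u _; rewrite [RHS]exchange_big.
apply: eq_bigr => w _; rewrite [RHS]exchange_big; apply: eq_bigr => z _.
rewrite [RHS]exchange_big; apply: eq_bigr => v _.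
by rewrite /contraction mulr_sumr mulr_suml.
Qed.

(** Reordered so that the indices chain as [v, z, w, u]: exchanging the two odd entries cancels the
    sign of [A u w = - A w u], and [(-1) ^+ r] comes from transposing an even power. *)
Let contractionE p q r i1 j1 i2 j2 u w z v :
  contraction ((A ^+ p.*2) i1 j1 * (A ^+ q.*2) i2 j2 * (A ^+ r.*2) w z) u w z v
  = (-1) ^+ r * ((A ^+ p.*2) i1 j1 * ((A ^+ q.*2) i2 j2
      * (A v z * (A ^+ r.*2) z w * A w u))).
Proof.
have cA m i j k l : A k l * (A ^+ m.*2) i j = (A ^+ m.*2) i j * A k l.
  by rewrite -[A]expr1 sq_pow_comm expr1.
rewrite /contraction -!mulrA (mulrA (A u w)) cA -mulrA (mulrA (A u w)) cA -mulrA.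
rewrite (mulrA (A u w)) cA -mulrA anticomm (skew u w) !mulrN opprK.
rewrite [(A ^+ r.*2) w z * _]mulrA -cA.
by rewrite (sq_pow_trmx r z w) !mulrA !commr_sign !mulrA.
Qed.

(** The factor at [u, v] closes the chain [v, z, w, u] into a cycle, hence into the trace of a
    positive even power. *)
Let con_closed p q r a b :
  con (fun u w z v => (A ^+ p.*2) a b * (A ^+ q.*2) u v * (A ^+ r.*2) w z) = 0.
Proof.
transitivity ((-1) ^+ r * ((A ^+ p.*2) a b * \tr (A ^+ q.*2 * A * A ^+ r.*2 * A))).
  rewrite /mxtrace 2!mulr_sumr; apply: eq_bigr => u _.
  rewrite [(_ * A) u u]mulmx4E 2!mulr_sumr; apply: eq_bigr => w _.
  rewrite 2!mulr_sumr; apply: eq_bigr => z _; rewrite 2!mulr_sumr.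
  by apply: eq_bigr => v _; rewrite contractionE !mulrA.
rewrite -exprSr -exprD -exprSr (_ : (q.*2.+1 + r.*2).+1 = (q + r).+1.*2); last by lia.
by rewrite tr_pow_even !mulr0.
Qed.

(** Here the chain runs from [a] through [v, z, w, u] to [b], which is one entry of a matrix
    product. *)
Let con_open p q r a b :
  con (fun u w z v => (A ^+ p.*2) a v * (A ^+ q.*2) u b * (A ^+ r.*2) w z)
  = (-1) ^+ r * (A ^+ (p + q + r).+1.*2) a b.
Proof.
have -> : A ^+ (p + q + r).+1.*2 = (A ^+ p.*2 * A * A ^+ r.*2 * A) * A ^+ q.*2.
  by rewrite -exprSr -exprD -exprSr -exprD; congr (_ ^+ _); lia.
rewrite mxE mulr_sumr; apply: eq_bigr => u _.
rewrite [(_ * A) a u]mulmx4E mulr_suml mulr_sumr; apply: eq_bigr => w _.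
rewrite mulr_suml mulr_sumr; apply: eq_bigr => z _; rewrite mulr_suml mulr_sumr.
apply: eq_bigr => v _; rewrite contractionE; congr (_ * _); rewrite -!mulrA; congr (_ * _).
have cA k l : A k l * (A ^+ q.*2) u b = (A ^+ q.*2) u b * A k l.
  by rewrite -[A]expr1 sq_pow_comm expr1.
by rewrite cA [(A ^+ r.*2) z w * (_ * A w u)]mulrA sq_pow_comm !mulrA cA.
Qed.

Lemma odd_skew_pow_eq0 : (0 < n)%N -> A ^+ n.*2 = 0.
Proof.
move=> n_gt0.
have [R [f [injf [B fB]]]] : exists (R : comNzRingType) (f : {rmorphism R -> E}),
    injective f /\ exists B, map_mx f B = A ^+ 2.
  by apply: commuting_lift => i j k l; apply: (sq_pow_comm 1).
have fBk k i j : f ((B ^+ k) i j) = (A ^+ k.*2) i j.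
  by rewrite -mul2n exprM -fB -rmorphXn mxE.
have chB := sq_char_poly injf fB.
apply/matrixP => a b; rewrite [RHS]mxE.
pose m1 p q r u w z v := (A ^+ p.*2) a b * (A ^+ q.*2) u v * (A ^+ r.*2) w z.
pose m3 p q r u w z v := (A ^+ p.*2) a v * (A ^+ q.*2) u b * (A ^+ r.*2) w z.
pose T (t : 'I_n.+1 * 'I_n.+1 * 'I_n.+1) := (t.1.1 + t.1.2 + t.2).+1 == n.
(* Up to exchanging [u] with [w] or [v] with [z], the six terms have two shapes: [m1] keeps the pair
   [a, b] together, [m3] separates it. *)
have minors : con (fun u w z v => \sum_(t | T t)
    (m1 t.1.1 t.1.2 t.2 u w z v - m1 t.1.1 t.1.2 t.2 u w v z
     - m3 t.1.1 t.1.2 t.2 u w z v + m3 t.1.1 t.2 t.1.2 w u z v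
     + m3 t.1.1 t.1.2 t.2 u w v z - m3 t.1.1 t.2 t.1.2 w u v z)) = 0.
  transitivity (con (fun _ _ _ _ => 0)); last first.
    by apply: big1 => u _; apply: big1 => w _; apply: big1 => z _; apply: big1 => v _;
      rewrite /contraction mulr0 mul0r.
  apply: eq_con => u w z v; have := congr1 f (resolvent_minor3 a u w b v z chB).
  rewrite rmorph0 rmorph_sum /= => E0; rewrite -[RHS]E0; apply: eq_bigr => t _.
  rewrite !(rmorphB, rmorphD, rmorphM) /= !fBk /m1 /m3.
  by rewrite -2![_ * (A ^+ t.2.*2) _ _ * _]mulrA 2![(A ^+ t.2.*2) _ _ * _]sq_pow_comm !mulrA.
have con1 p q r : con (m1 p q r) = 0 by exact: con_closed.
have con3 (t : 'I_n.+1 * 'I_n.+1 * 'I_n.+1) : T t ->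
    con (m3 t.1.1 t.1.2 t.2) = (-1) ^+ t.2 * (A ^+ n.*2) a b.
  by move=> /eqP Tt; rewrite con_open Tt.
have con3' (t : 'I_n.+1 * 'I_n.+1 * 'I_n.+1) : T t ->
    con (m3 t.1.1 t.2 t.1.2) = (-1) ^+ t.1.2 * (A ^+ n.*2) a b.
  by move=> /eqP Tt; rewrite con_open addnAC Tt.
pose X := (A ^+ n.*2) a b.
have Sr : \sum_(t | T t) (-1) ^+ t.2 * X = X *+ uphalf n.
  by rewrite -mulr_suml sum_sign_compositions mulr_natl.
have Sq : \sum_(t | T t) (-1) ^+ t.1.2 * X = X *+ uphalf n.
  pose h (t : 'I_n.+1 * 'I_n.+1 * 'I_n.+1) := (t.1.1, t.2, t.1.2).
  have hK : involutive h by case=> [[]].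
  rewrite -Sr (reindex_inj (inv_inj hK)); apply: eq_bigl => t.
  by rewrite /T /= addnAC.
(* The sums [Sr] and [Sq] each arise twice, all with the same sign; [n > 0] makes the coefficient a
   successor. *)
have : X *+ (uphalf n * 4).-1.+1 = 0; last exact: torsion_free.
rewrite prednK ?muln_gt0 ?uphalf_gt0 ?n_gt0 // mulrnA.
rewrite -[RHS]oppr0 -[in RHS]minors con_sum -sumrN.
transitivity (\sum_(t | T t) ((-1) ^+ t.2 * X + (-1) ^+ t.1.2 * X) *+ 2).
  by rewrite sumrMnl big_split /= Sr Sq -mulr2n -[RHS]mulrnA.
apply: eq_bigr => t Tt.
rewrite !(conD, conN) (con_swapr (m1 t.1.1 t.1.2 t.2)) con1 (con_swapr (m3 t.1.1 t.1.2 t.2)).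
rewrite (con_swapr (fun u w => m3 t.1.1 t.2 t.1.2 w u)) (con_swapl (m3 t.1.1 t.2 t.1.2)).
by rewrite con3 // con3' // !opprD !opprK oppr0 !add0r mulr2n !addrA.
Qed.

End OddSkew.

(** * Upper triangular 2 x 2 matrices *)

Section UpperTriangular.
Variable E : nzRingType.

Definition uptri2 (x y z : E) : 'M[E]_2 :=
  block_mx (x%:M : 'M_1) (y%:M : 'M_1) 0 (z%:M : 'M_1).

Lemma uptri2M x y z x' y' z' :
  uptri2 x y z * uptri2 x' y' z' = uptri2 (x * x') (x * y' + y * z') (z * z').
Proof.
have e2 := mulmx_block (x%:M : 'M_1) y%:M 0 z%:M (x'%:M : 'M_1) y'%:M 0 z'%:M.
apply: (etrans e2).
by rewrite !mulmx0 !mul0mx !addr0 add0r -!scalar_mxM -raddfD.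
Qed.

Lemma uptri2N x y z : - uptri2 x y z = uptri2 (- x) (- y) (- z).
Proof.
by apply: (etrans (opp_block_mx (x%:M : 'M_1) y%:M 0 z%:M)); rewrite oppr0 -!raddfN.
Qed.

Lemma uptri2D x y z x' y' z' :
  uptri2 x y z + uptri2 x' y' z' = uptri2 (x + x') (y + y') (z + z').
Proof.
apply: (etrans (add_block_mx (x%:M : 'M_1) y%:M 0 z%:M (x'%:M : 'M_1) y'%:M 0 z'%:M)).
by rewrite addr0 -!raddfD.
Qed.

Lemma uptri20 : uptri2 0 0 0 = 0.
Proof. by rewrite /uptri2 !raddf0; apply: (@block_mx0 E 1 1 1 1). Qed.

Lemma uptri21 : uptri2 1 0 1 = 1.
Proof. by rewrite /uptri2 raddf0; apply/esym/(@scalar_mx_block E 1 1). Qed.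

Lemma uptri2_sum (I : finType) (x y z : I -> E) :
  \sum_i uptri2 (x i) (y i) (z i) = uptri2 (\sum_i x i) (\sum_i y i) (\sum_i z i).
Proof.
elim: (index_enum I) => [|i r IH]; first by rewrite !big_nil uptri20.
by rewrite !big_cons IH uptri2D.
Qed.

Lemma uptri2_eq0 x y z : uptri2 x y z = 0 -> y = 0.
Proof.
move=> /(congr1 (fun M : 'M_(1 + 1) => ursubmx M ord0 ord0)).
by rewrite block_mxKur !mxE.
Qed.

End UpperTriangular.

(** * Sums split by parity *)

Lemma sum_ord_double (V : nmodType) n (F : nat -> V) :
  \sum_(i < n.*2) F i = \sum_(k < n) (F k.*2 + F k.*2.+1).
Proof.
elim: n => [|n IH]; first by rewrite !big_ord0.
by rewrite doubleS !big_ord_recr /= IH addrA.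
Qed.

Lemma sum_ord_odd (V : nmodType) n (F : nat -> V) :
  (forall k, F k.*2 = 0) -> \sum_(i < n) F i = \sum_(k < n./2) F k.*2.+1.
Proof.
move=> F0; elim: n => [|n IH]; first by rewrite !big_ord0.
rewrite big_ord_recr /= IH uphalf_half; have := odd_double_half n.
case: (odd n) => /= nE; last by rewrite -[in F _]nE add0n F0 addr0.
by rewrite add1n big_ord_recr /= -[in F n]nE.
Qed.

(** The terms [i = 2k] and [i = 2k + 1] both equal [(-1) ^+ k], so successive pairs cancel and one
    pair is left for odd [n]. *)
Lemma sum_trace_signs (R : nzRingType) n :
  \sum_(i < n.*2) (-1) ^+ (i + 'C(i.+1, 2)) = (odd n).*2%:R :> R.
Proof.
rewrite (sum_ord_double _ (fun i => (-1) ^+ (i + 'C(i.+1, 2)))).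
have sE k : (-1) ^+ (k.*2 + 'C(k.*2.+1, 2)) + (-1) ^+ (k.*2.+1 + 'C(k.*2.+2, 2))
    = (-1) ^+ k *+ 2 :> R.
  have := bin2_sign R k; rewrite (binS k.*2.+1) bin1.
  move: 'C(k.*2.+1, 2) => c ck; rewrite !(exprD, exprS) ck.
  have -> : (-1) ^+ k.*2 = 1 :> R by rewrite -signr_odd odd_double.
  by rewrite !mulr1 !mul1r mulrN1 mulN1r opprK mulr2n.
under eq_bigr do rewrite sE.
elim: n => [|n IH]; first by rewrite big_ord0.
rewrite big_ord_recr IH /= -signr_odd.
by case: (odd n); rewrite /= ?add0r // mulNrn subrr.
Qed.

(** * Polarization and the trace identity *)

Section Polarization.
Variables (E : nzRingType) (n : nat) (A : 'M[E]_n.+1).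
Hypothesis torsion_free : forall (x : E) k, x *+ k.+1 = 0 -> x = 0.
Hypothesis anticomm : forall i j k l, A i j * A k l = - (A k l * A i j).
Hypothesis skew : forall i j, A i j = - A j i.

Lemma odd_skew_polarized (Y : 'M[E]_n.+1) :
  (0 < n)%N -> (forall i j k l, GRing.comm (Y i j) (A k l)) ->
  (forall i j, Y i j = - Y j i) ->
  \sum_(i < n.*2) A ^+ i * Y * (- A) ^+ (n.*2.-1 - i) = 0.
Proof.
move=> n_gt0 cYA skY.
(* [Y] commutes with [A], so the corner [- A] is what makes the off-diagonal parts of these entries
   anticommute. *)
pose A2 : 'M['M[E]_2]_n.+1 := \matrix_(i, j) uptri2 (A i j) (Y i j) (- A i j).
(* The upper right corner of [A2 ^+ k]. *)
pose D k := \sum_(i < k) A ^+ i * Y * (- A) ^+ (k.-1 - i).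
have DS k : D k.+1 = A ^+ k * Y + D k * - A.
  rewrite /D big_ord_recr /= subnn expr0 mulr1 addrC mulr_suml; congr (_ + _).
  apply: eq_bigr => i _; rewrite -[RHS]mulrA -exprSr; congr (_ * _ ^+ _).
  by have := ltn_ord i; lia.
have A2k k : A2 ^+ k = \matrix_(i, j) uptri2 ((A ^+ k) i j) (D k i j) (((- A) ^+ k) i j).
  elim: k => [|k IH].
    apply/matrixP => i j; rewrite !mxE /D big_ord0 mxE.
    by case: (i == j); rewrite ?uptri21 ?uptri20.
  rewrite exprSr IH; apply/matrixP => i j; rewrite DS !exprSr !mxE.
  under eq_bigr do rewrite !mxE uptri2M.
  by rewrite uptri2_sum -big_split; congr uptri2; apply: eq_bigr => s _; rewrite !mxE.
have : A2 ^+ n.*2 = 0.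
  apply: odd_skew_pow_eq0 => //.
  - move=> x k /matrixP x0; apply/matrixP => i j; rewrite [RHS]mxE.
    by apply: (@torsion_free _ k); have := x0 i j; rewrite mulmxnE mxE.
  - move=> i j k l; rewrite !mxE !uptri2M uptri2N; congr uptri2; first exact: anticomm.
      by rewrite -!cYA !mulrN !opprD opprK addrC !cYA.
    by rewrite !mulrNN anticomm.
  - by move=> i j; rewrite !mxE uptri2N (skew i j) (skY i j).
rewrite A2k => /matrixP A20; apply/matrixP => i j.
by have := A20 i j; rewrite !mxE => /uptri2_eq0.
Qed.


Let mul_delta (M1 M2 : 'M[E]_n.+1) p q a b :
  (M1 * delta_mx p q * M2) a b = M1 a p * M2 q b.
Proof.
rewrite mxE (bigD1 q) //= mxE (bigD1 p) //= mxE !eqxx mulr1.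
rewrite !big1 ?addr0 // => [k /negPf kq | k /negPf kp].
  rewrite mxE big1 ?mul0r // => l _.
  by rewrite mxE kq andbF mulr0.
by rewrite mxE kp mulr0.
Qed.

Let mul_skew_delta (M1 M2 : 'M[E]_n.+1) p q a b :
  (M1 * (delta_mx p q - delta_mx q p) * M2) a b = M1 a p * M2 q b - M1 a q * M2 p b.
Proof. by rewrite mulrBr mulrBl [LHS]mxE [X in _ + X]mxE !mul_delta. Qed.

Let polarized_entry a p q b : (0 < n)%N ->
  \sum_(i < n.*2) (-1) ^+ i * ((A ^+ i) a p * (A ^+ (n.*2.-1 - i)) q b)
  = \sum_(i < n.*2) (-1) ^+ i * ((A ^+ i) a q * (A ^+ (n.*2.-1 - i)) p b).
Proof.
move=> n_gt0; pose Y : 'M[E]_n.+1 := delta_mx p q - delta_mx q p.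
have /matrixP/(_ a b) : \sum_(i < n.*2) A ^+ i * Y * (- A) ^+ (n.*2.-1 - i) = 0.
  apply: odd_skew_polarized => // [i j k l | i j].
    by rewrite !mxE; apply/commr_sym/commrB; apply: commr_nat.
  by rewrite !mxE opprB ![(i == _) && _]andbC.
rewrite summxE [RHS]mxE => /(congr1 -%R); rewrite oppr0 -sumrN => E0.
apply/eqP; rewrite -subr_eq0 -sumrB -[0 in X in _ == X]E0; apply/eqP; apply: eq_bigr => i _.
(* The exponents [i] and [n.*2.-1 - i] have opposite parity. *)
have NA c d : ((- A) ^+ (n.*2.-1 - i)) c d = - ((-1) ^+ i * (A ^+ (n.*2.-1 - i)) c d).
  have odd_e : odd (n.*2.-1 - i) = ~~ odd i by have := ltn_ord i; lia.
  rewrite (exprNn A) -[(-1) ^+ (_ - _)]signr_odd odd_e -[(-1) ^+ i]signr_odd.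
  by case: (odd i); rewrite /= ?expr0 ?expr1 ?mulN1r ?mul1r ?opprK // mxE.
rewrite mul_skew_delta !NA.
rewrite !mulrN opprD !opprK.
by rewrite !mulrA !commr_sign addrC.
Qed.

(** Serves both parities: in size [N = n.+1] the exponent is [2N - 3], and the right side carries
    the factor 2 for even [N], 0 for odd [N]. *)
Lemma odd_skew_trace_identity : (0 < n)%N ->
  A ^+ n.*2.-1 *+ n.+1
  - \sum_(k < n./2) \tr (A ^+ (4 * k + 3)) *: A ^+ (n.*2.-1 - (4 * k + 3))
  = A ^+ n.*2.-1 *+ (odd n).*2.
Proof.
move=> n_gt0; apply/matrixP => q b.
pose G i := (-1) ^+ i * (\tr (A ^+ i) * (A ^+ (n.*2.-1 - i)) q b).
have sumG : \sum_(i < n.*2) G i = (A ^+ n.*2.-1) q b *+ (odd n).*2.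
  (* Taking [p = a] in [polarized_entry] turns the trace into a product of entries [a, q] and
     [a, b]; one transposition makes it a matrix product. *)
  transitivity (\sum_a \sum_(i < n.*2) (-1) ^+ i * ((A ^+ i) a a * (A ^+ (n.*2.-1 - i)) q b)).
    by rewrite exchange_big; apply: eq_bigr => i _; rewrite -mulr_sumr -mulr_suml.
  under eq_bigr do rewrite polarized_entry //.
  rewrite exchange_big -mulr_natl -(sum_trace_signs E) mulr_suml.
  apply: eq_bigr => i _; rewrite exprD -mulrA -mulr_sumr; congr (_ * _).
  have -> : A ^+ n.*2.-1 = A ^+ i * A ^+ (n.*2.-1 - i).
    by rewrite -exprD subnKC //; have := ltn_ord i; lia.
  rewrite mxE mulr_sumr; apply: eq_bigr => a _.
  by rewrite (pow_trmx anticomm skew _ q a) mulrA.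
rewrite mulmxnE -sumG sum_ord_double big_split /= !mxE mulmxnE summxE -sumrN.
congr (_ + _).
  (* Among even [i] only [i = 0] survives, with trace [n.+1]. *)
  rewrite (bigD1 (Ordinal n_gt0)) //= big1 ?addr0 => [|[[|k] ltkn] // _].
    by rewrite /G mul1r expr0 mxtrace1 mulr_natl subn0.
  by rewrite /G tr_pow_even // mul0r mulr0.
rewrite (sum_ord_odd _ (F := fun k => G k.*2.+1)) => [|k]; last first.
  (* Transposition changes the sign of the diagonal, since ['C(4k + 2, 2)] is odd. *)
  have tr0 : \tr (A ^+ k.*2.*2.+1) = 0.
    apply: (@torsion_free _ 1); rewrite mulr2n; apply/eqP; rewrite addr_eq0; apply/eqP.
    rewrite -sumrN; apply: eq_bigr => i _; rewrite {1}(pow_trmx anticomm skew).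
    have := bin2_sign E k.*2; rewrite (binS k.*2.*2.+1) bin1.
    move: 'C(k.*2.*2.+1, 2) => c ck.
    rewrite (exprD _ c) ck exprS -[(-1) ^+ k.*2]signr_odd -[(-1) ^+ k.*2.*2]signr_odd.
    by rewrite !odd_double mul1r mulr1 mulN1r.
  by rewrite /G tr0 mul0r mulr0.
apply: eq_bigr => k _; rewrite !mxE /G (_ : (4 * k + 3)%N = k.*2.+1.*2.+1); last by lia.
by rewrite -[(-1) ^+ _]signr_odd /= odd_double expr1 mulN1r.
Qed.

End Polarization.

(** * The exterior algebra as a ring *)

(** A separate name keeps the exterior product apart from the pointwise product of functions. *)
Definition ext_ring (n : nat) : Type := ext n.

HB.instance Definition _ n := GRing.Zmodule.copy (ext_ring n) (ext n).

Section ExteriorRing.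
Variable n : nat.
Implicit Types (S T Z U : {set pairs n}) (x y z : ext n).

Lemma ext_invE S T :
  ext_inv S T = (\sum_(s in S) \sum_(t in T) (enum_rank t < enum_rank s))%N.
Proof.
rewrite /ext_inv -sum1dep_card big_mkcond pair_big [in RHS]big_mkcond /=.
apply: eq_bigr => -[s t] _ /=.
by case: (s \in S); case: (t \in T) => //=; case: ltnP.
Qed.

Definition ext_sign S T : CC := if [disjoint S & T] then (-1) ^+ ext_inv S T else 0.

Lemma ext_sign0l T : ext_sign set0 T = 1.
Proof. by rewrite /ext_sign -setI_eq0 set0I eqxx ext_invE big_set0. Qed.

Lemma ext_sign0r S : ext_sign S set0 = 1.
Proof.
by rewrite /ext_sign -setI_eq0 setI0 eqxx ext_invE big1 // => s _; rewrite big_set0.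
Qed.

(** Associativity on basis vectors: both sides require pairwise disjointness, and inversion counts
    add over disjoint unions. *)
Lemma ext_sign_cocycle S T Z :
  ext_sign S T * ext_sign (S :|: T) Z = ext_sign S (T :|: Z) * ext_sign T Z.
Proof.
have dU (A B C : {set pairs n}) :
    [disjoint A :|: B & C] = [disjoint A & C] && [disjoint B & C].
  by rewrite -!setI_eq0 setIUl setU_eq0.
rewrite /ext_sign dU ![[disjoint S & _ :|: _]]disjoint_sym dU.
rewrite ![[disjoint _ & S]]disjoint_sym.
case: (boolP [disjoint S & T]) => [dST | _]; last by rewrite !mul0r.
case: (boolP [disjoint S & Z]) => [_ | _]; last by rewrite mul0r mulr0.
case: (boolP [disjoint T & Z]) => [dTZ | _]; last by rewrite !mulr0.
have sumU (A B : {set pairs n}) (F : pairs n -> nat) : [disjoint A & B] ->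
    (\sum_(s in A :|: B) F s = \sum_(s in A) F s + \sum_(s in B) F s)%N.
  by move=> dAB; rewrite -bigU //; apply: eq_bigl => s; rewrite !inE.
rewrite -!exprD !ext_invE sumU // addnA; congr (_ ^+ (_ + _)).
by rewrite -big_split; apply: eq_bigr => s _; rewrite sumU.
Qed.

Lemma ext_mulE x y U :
  ext_mul x y U = \sum_S \sum_T (S :|: T == U)%:R * (ext_sign S T * x S * y T).
Proof.
rewrite ffunE; apply: eq_bigr => S _; apply: eq_bigr => T _; rewrite /ext_sign.
by case: [disjoint S & T]; case: (S :|: T == U); rewrite /= ?mul0r ?mul1r.
Qed.

Lemma sum_eq_nat_mul (I : finType) (R : pzSemiRingType) (i : I) (F : I -> R) :
  \sum_j (i == j)%:R * F j = F i.
Proof.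
rewrite (bigD1 i) //= eqxx mul1r big1 ?addr0 // => j /negPf ji.
by rewrite eq_sym ji mul0r.
Qed.

(** Both bracketings become one sum over triples [S, T, Z], once the intermediate union [W] is
    summed out. *)
Lemma ext_mulA : associative (@ext_mul n).
Proof.
move=> x y z; apply/ffunP => U; rewrite !ext_mulE.
transitivity (\sum_S \sum_T \sum_Z (S :|: T :|: Z == U)%:R
    * (ext_sign S T * ext_sign (S :|: T) Z * x S * y T * z Z)).
  apply: eq_bigr => S _.
  transitivity (\sum_W \sum_T \sum_Z (T :|: Z == W)%:R * ((S :|: W == U)%:R
      * (ext_sign S W * ext_sign T Z * x S * y T * z Z))).
    apply: eq_bigr => W _; rewrite ext_mulE mulr_sumr mulr_sumr.
    apply: eq_bigr => T _; rewrite 2!mulr_sumr; apply: eq_bigr => Z _; ring.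
  rewrite exchange_big; apply: eq_bigr => T _; rewrite exchange_big.
  apply: eq_bigr => Z _; rewrite sum_eq_nat_mul setUA.
  by rewrite ext_sign_cocycle.
transitivity (\sum_W \sum_S \sum_T \sum_Z (S :|: T == W)%:R * ((W :|: Z == U)%:R
      * (ext_sign S T * ext_sign W Z * x S * y T * z Z))).
  rewrite [RHS]exchange_big; apply: eq_bigr => S _; rewrite [RHS]exchange_big.
  apply: eq_bigr => T _; rewrite [RHS]exchange_big; apply: eq_bigr => Z _.
  by rewrite sum_eq_nat_mul.
apply: eq_bigr => W _; under eq_bigr do rewrite exchange_big.
rewrite exchange_big; apply: eq_bigr => Z _.
rewrite ext_mulE mulr_sumr mulr_suml mulr_sumr; apply: eq_bigr => S _.
rewrite mulr_sumr mulr_suml mulr_sumr; apply: eq_bigr => T _; ring.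
Qed.

Lemma ext_mul1l : left_id (ext_one n) (@ext_mul n).
Proof.
move=> x; apply/ffunP => U; rewrite ext_mulE (bigD1 set0) //= [X in _ + X]big1 ?addr0.
  under eq_bigr do rewrite set0U ext_sign0l ffunE eqxx !mul1r eq_sym.
  by rewrite sum_eq_nat_mul.
by move=> S /negPf S0; rewrite big1 // => T _; rewrite ffunE S0 mulr0 mul0r mulr0.
Qed.

Lemma ext_mul1r : right_id (ext_one n) (@ext_mul n).
Proof.
move=> x; apply/ffunP => U; rewrite ext_mulE exchange_big (bigD1 set0) //=.
rewrite [X in _ + X]big1 ?addr0.
  under eq_bigr do rewrite setU0 ext_sign0r ffunE eqxx mulr1 mul1r eq_sym.
  by rewrite sum_eq_nat_mul.
by move=> S /negPf S0; rewrite big1 // => T _; rewrite ffunE S0 !mulr0.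
Qed.

Lemma ext_mulDl : left_distributive (@ext_mul n) +%R.
Proof.
move=> x y z; apply/ffunP => U; rewrite [RHS]ffunE !ext_mulE -big_split.
apply: eq_bigr => S _; rewrite -big_split; apply: eq_bigr => T _; rewrite ffunE /=; ring.
Qed.

Lemma ext_mulDr : right_distributive (@ext_mul n) +%R.
Proof.
move=> x y z; apply/ffunP => U; rewrite [RHS]ffunE !ext_mulE -big_split.
apply: eq_bigr => S _; rewrite -big_split; apply: eq_bigr => T _; rewrite ffunE /=; ring.
Qed.

Lemma ext_one_neq0 : ext_one n != 0 :> ext n.
Proof. by apply/eqP => /ffunP/(_ set0)/eqP; rewrite !ffunE eqxx oner_eq0. Qed.

HB.instance Definition _ := GRing.Zmodule_isNzRing.Build (ext_ring n)
  ext_mulA ext_mul1l ext_mul1r ext_mulDl ext_mulDr ext_one_neq0.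

Lemma ext_torsion_free (x : ext_ring n) k : x *+ k.+1 = 0 -> x = 0.
Proof.
move=> x0; apply/ffunP => S; rewrite [RHS]ffunE; apply/eqP.
have /ffunP/(_ S)/eqP := x0; rewrite ffunMnE ffunE.
(* [CC] is declared as a bare field; the ascription recovers the numeric structure that gives
   characteristic zero. *)
by rewrite -[_ *+ _]/((x S : Rdefinitions.R[i]) *+ k.+1) Num.Theory.mulrn_eq0.
Qed.

(** Of the two orders of distinct generators exactly one has an inversion; equal generators are not
    disjoint and give zero. *)
Lemma ext_gen_anticomm (g h : pairs n) :
  ext_mul (ext_gen g) (ext_gen h) = - ext_mul (ext_gen h) (ext_gen g).
Proof.
have genE k l U : ext_mul (ext_gen k) (ext_gen l) U
    = ([set k] :|: [set l] == U)%:R * ext_sign [set k] [set l].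
  rewrite ext_mulE (bigD1 [set k]) //= (bigD1 [set l]) //= !ffunE !eqxx !mulr1.
  rewrite !big1 ?addr0 // => [S /negPf Sk | T /negPf Tl].
    by rewrite big1 // => T _; rewrite ffunE Sk mulr0 mul0r mulr0.
  by rewrite [ext_gen l _]ffunE Tl !mulr0.
apply/ffunP => U; rewrite [RHS]ffunE !genE setUC -mulrN; congr (_ * _).
rewrite /ext_sign !disjoints1 !inE [h == g]eq_sym; case: (altP (g =P h)) => [_|ngh].
  by rewrite oppr0.
rewrite !ext_invE !big_set1.
have : enum_rank g != enum_rank h by rewrite (inj_eq enum_rank_inj).
by rewrite neq_ltn => /orP[] lt; rewrite lt ltnNge (ltnW lt) ?opprK.
Qed.


(* The ascriptions to [ext_ring n] select the exterior product; on [ext n]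
   itself [*] would be the pointwise product of functions. *)
Definition wedge_ring (i j : 'I_n) : ext_ring n := wedge2 i j.
Definition entry_ring (i j : 'I_n) : ext_ring n := a_entry i j.

Lemma wedge_ring_anticomm i j k l :
  wedge_ring i j * wedge_ring k l = - (wedge_ring k l * wedge_ring i j).
Proof.
rewrite /wedge_ring /wedge2; case: insubP => [g _ _|_]; last by rewrite mul0r mulr0 oppr0.
case: insubP => [h _ _|_]; last by rewrite mul0r mulr0 oppr0.
exact: ext_gen_anticomm.
Qed.

Lemma entry_ring_anticomm i j k l :
  entry_ring i j * entry_ring k l = - (entry_ring k l * entry_ring i j).
Proof.
have aE p q : entry_ring p q = wedge_ring p q - wedge_ring q p by [].
rewrite !aE mulrBl !mulrBr !opprB.
rewrite (wedge_ring_anticomm i j k l) (wedge_ring_anticomm i j l k).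
rewrite (wedge_ring_anticomm j i k l) (wedge_ring_anticomm j i l k).
by rewrite !opprK !mulrBl opprB [RHS]addrC; congr (_ + _); apply: addrC.
Qed.

Lemma entry_ringN i j : entry_ring i j = - entry_ring j i.
Proof. by apply/esym; apply: (opprB (wedge_ring j i)). Qed.

End ExteriorRing.

(** * From the exterior ring to the stated identities *)

Lemma mxpowE_ring n (M : 'M[ext n.+1]_n.+1) k :
  mxpowE M k = (M : 'M[ext_ring n.+1]_n.+1) ^+ k.
Proof.
elim: k => [|k IH]; first by apply/matrixP => i j; rewrite !mxE.
by rewrite exprS -IH; apply/matrixP => i j; rewrite !mxE.
Qed.

Theorem theorem4p12 (n m : nat) : (2 <= n)%N ->
  ((n = 2 * m)%N ->
     (mxpowE (Amx n) (2 * n - 3)) *+ (n - 2)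
     - \sum_(k < m.-1)
         mxscaleE (mxtrE (mxpowE (Amx n) (4 * k + 3)))
                  (mxpowE (Amx n) (2 * n - 3 - (4 * k + 3)))
     = 0) /\
  ((n = 2 * m + 1)%N ->
     (mxpowE (Amx n) (2 * n - 3)) *+ n
     - \sum_(k < m)
         mxscaleE (mxtrE (mxpowE (Amx n) (4 * k + 3)))
                  (mxpowE (Amx n) (2 * n - 3 - (4 * k + 3)))
     = 0).
Proof.
case: n => [|[|n]] // _; set N := n.+2.
pose A : 'M[ext_ring N]_N := Amx N.
have scaleE e k : mxscaleE (mxtrE (mxpowE (Amx N) k)) (mxpowE (Amx N) e)
    = \tr (A ^+ k) *: A ^+ e.
  by rewrite !mxpowE_ring; apply/matrixP => a b; rewrite !mxE.
have traceA : A ^+ (2 * N - 3) *+ N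
  - \sum_(k < n.+1./2) \tr (A ^+ (4 * k + 3)) *: A ^+ (2 * N - 3 - (4 * k + 3))
  = A ^+ (2 * N - 3) *+ (odd n.+1).*2.
  have -> : (2 * N - 3)%N = n.+1.*2.-1 by rewrite /N; lia.
  apply: odd_skew_trace_identity => // [|i j k l|i j].
  - exact: ext_torsion_free.
  - by rewrite !mxE; apply: entry_ring_anticomm.
  - by rewrite !mxE; apply: entry_ringN.
have sumE M (e := (2 * N - 3)%N) :
    \sum_(k < M) mxscaleE (mxtrE (mxpowE (Amx N) (4 * k + 3)))
                  (mxpowE (Amx N) (e - (4 * k + 3)))
  = \sum_(k < M) \tr (A ^+ (4 * k + 3)) *: A ^+ (e - (4 * k + 3)).
  by apply: eq_bigr => k _; apply: scaleE.
(* The size is [N = n.+2], so [n.+1./2] is [m - 1] for [N = 2m] and [m] for [N = 2m + 1]; only even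
   [N] leaves two copies to subtract. *)
split=> Nm; rewrite sumE mxpowE_ring.
  have -> : m.-1 = n.+1./2 by rewrite /N in Nm; lia.
  have odd_n1 : (odd n.+1).*2 = 2%N by rewrite /N in Nm; lia.
  have mulrnN (X : 'M[ext_ring N]_N) : X *+ N = X *+ 2 + X *+ (N - 2).
    by rewrite -mulrnDr subnKC.
  move: traceA; rewrite odd_n1 mulrnN -addrA => /eqP.
  rewrite -subr_eq0 addrAC subrr add0r => /eqP E0; exact: E0.
have -> : m = n.+1./2 by rewrite /N in Nm; lia.
have odd_n1 : (odd n.+1).*2 = 0%N by rewrite /N in Nm; lia.
by move: traceA; rewrite odd_n1.
Qed.
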